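(* Let $r$ be any real number. For all integers $n,k$ with $n-1\geq k\geq 0$, we have $$t_r(n+1+r,k+r)=t_r(n-1+r,k-2+r)+2r\,t_r(n-1+r,k-1+r)+\left(r^2-\left(\frac{n-1}{2}\right)^2\right)t_r(n-1+r,k+r).$$
   Context: Central factorials: $x^{[0]}=1$ and, for $n\ge 1$, $x^{[n]}=x\prod_{j=1}^{n-1}\left(x+\frac n2-j\right)=x\left(x+\frac n2-1\right)\left(x+\frac n2-2\right)\cdots\left(x-\frac n2+1\right)$. For a real number $r$, the extended $r$-central factorial numbers of the first kind $t_r(n+r,k+r)$ ($0\le k\le n$) are defined by the polynomial identity in $x$ $$(x+r)^{[n]}=\sum_{k=0}^n t_r(n+r,k+r)x^k,\qquad n\ge 0,$$ where $(x+r)^{[n]}$ is the central factorial $y^{[n]}$ evaluated at $y=x+r$. Thus $t_r(n+r,k+r)$ is, for fixed $r$, a function of the pair $(n,k)$. Convention: $t_r(n+r,j+r)=0$ for $j<0$. *)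

(* Defs.v *)
From HB Require Import structures.
From mathcomp Require Import all_boot all_order all_algebra.
From mathcomp Require Import reals.

Set Implicit Arguments.
Unset Strict Implicit.
Unset Printing Implicit Defensive.

Import Order.TTheory GRing.Theory Num.Theory.

Local Open Scope ring_scope.

(* x^[n], as a polynomial in its argument x *)
Definition central_factorial (R : realType) (n : nat) : {poly R} :=
  if n is 0%N then 1
  else 'X * \prod_(1 <= j < n) ('X + (n%:R / 2 - j%:R)%:P).

(* [t1 r n k] is t_r(n+r, k+r): the shifts by r are left out of the indices.
   The index k is an integer, to accommodate the convention that
   t_r(n+r, k+r) = 0 for k < 0. *)
Definition t1 (R : realType) (r : R) (n : nat) (k : int) : R :=
  match k with
  | Posz k' => (central_factorial R n \Po ('X + r%:P))`_k'
  | Negz _ => 0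
  end.

Lemma size_central_factorial (R : realType) (n : nat) :
  size (central_factorial R n) = n.+1.
Proof.
case: n => [|n]; first by rewrite /= size_poly1.
rewrite /central_factorial.
rewrite (eq_bigr (fun j : nat => 'X - (- (n.+1%:R / 2 - j%:R))%:P)); last first.
  by move=> j _; rewrite polyCN opprK.
rewrite size_Mmonic ?polyX_eq0 ?monic_prod_XsubC //.
by rewrite size_prod_XsubC size_iota size_polyX subn1 /=.
Qed.

Lemma t1_def (R : realType) (r : R) (n : nat) (x : R) :
  (central_factorial R n).[x + r] = \sum_(k < n.+1) t1 r n k%:Z * x ^+ k.
Proof.
have <- : (central_factorial R n \Po ('X + r%:P)).[x]
          = (central_factorial R n).[x + r].
  by rewrite horner_comp !hornerE.
apply: horner_coef_wide.
by rewrite -[r]opprK polyCN size_comp_poly2 ?size_XsubC ?size_central_factorial.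
Qed.

(* Main.v *)
(* Raising n by 2 shifts the linear factors of x^[n] by one index and adds the
   two outer factors x + n/2 and x - n/2, so x^[n+2] = x^[n] (x^2 - (n/2)^2).
   Substituting x + r and comparing coefficients of x^k gives the recurrence. *)
Require Import Defs.
From mathcomp Require Import all_boot all_order all_algebra.
From mathcomp Require Import reals.
From mathcomp Require Import ring zify.

Import Order.TTheory GRing.Theory Num.Theory.

Local Open Scope ring_scope.

Lemma central_factorialSS (R : realType) (n : nat) :
  central_factorial R n.+2
  = central_factorial R n * ('X ^+ 2 - ((n%:R / 2) ^+ 2)%:P).
Proof.
(* x^[0] = 1 lacks the leading factor ['X], so this case is computed directly. *)
case: n => [|n].
  by rewrite /central_factorial big_nat1 divff ?pnatr_eq0 // subrr mul0r expr0n
             /= !polyC0 addr0 subr0 mul1r.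
rewrite /central_factorial big_nat_recl // big_nat_recr //=.
have two_neq0 : (2 : R) != 0 by rewrite pnatr_eq0.
(* The split-off factors j = 1 and j = n+2 are the outer pair. *)
have -> : n.+3%:R / 2 - 1%:R = n.+1%:R / 2 :> R by field.
have -> : n.+3%:R / 2 - n.+2%:R = - (n.+1%:R / 2) :> R by field.
rewrite (eq_bigr (fun j => 'X + (n.+1%:R / 2 - j%:R)%:P)); last first.
  by move=> j _; congr (_ + _%:P); field.
rewrite polyCN rmorphXn /=; ring.
Qed.

(** Expanding (X + r)^2 in powers of X leaves each factor ['X] as a shift of the coefficient
    index. *)
Lemma comp_central_factorialSS (R : realType) (r : R) (n : nat) :
  central_factorial R n.+2 \Po ('X + r%:P)
  = let q := central_factorial R n \Po ('X + r%:P) in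
    q * 'X * 'X + (2 * r)%:P * (q * 'X) + (r ^+ 2 - (n%:R / 2) ^+ 2)%:P * q.
Proof.
rewrite central_factorialSS comp_polyM comp_polyB comp_polyC comp_Xn_poly /=.
rewrite polyCB (polyCM 2 r) (rmorph_nat polyC 2) (rmorphXn polyC 2 r) /=.
ring.
Qed.

Theorem theorem3p1 (R : realType) (r : R) (n k : nat)
    (hkn : k%:Z <= n%:Z - 1) :
  t1 r n.+1 k%:Z =
    t1 r n.-1 (k%:Z - 2) + 2 * r * t1 r n.-1 (k%:Z - 1)
    + (r ^+ 2 - ((n%:R - 1) / 2) ^+ 2) * t1 r n.-1 k%:Z.
Proof.
(* For n = 0 the hypothesis would give k <= -1; afterwards [n.-1] is a true predecessor. *)
case: n hkn => [|n] hkn; first by lia.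
rewrite -[n.+1%:R]natr1 addrK [n.+1.-1]/=.
rewrite [LHS]/t1 comp_central_factorialSS /= !coefD !coefCM !coefMX.
(* For k = 0, 1 the zero coefficients produced by the shifts match the convention at negative
   indices. *)
case: k {hkn} => [|[|k]] //=.
by rewrite subn1 !subSS subn0.
Qed.
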